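(* Let $1<q<\infty$. The minimal constant $\bar{C}_{1,\infty}(q)>0$ for which $$\sup_{t>0}\,tf(t)\leq\bar{C}_{1,\infty}(q)\sup_{t>0}\,t\left(\frac{1}{t}\int_t^\infty f(s)^q\,\mathrm{d}s\right)^{\frac{1}{q}}$$ holds for all monotonically decreasing functions $f:(0,\infty)\to[0,\infty)$ is $$\bar{C}_{1,\infty}(q)=\left(\frac{1}{q}\right)^{-\frac{1}{q}}\left(1-\frac{1}{q}\right)^{-\left(1-\frac{1}{q}\right)}.$$
   Context: Suprema of nonnegative quantities and integrals of nonnegative functions take values in $[0,\infty]$. ''Monotonically decreasing'' means $f(s)\geq f(t)$ whenever $0<s\leq t$ (not necessarily strictly). *)

(* Defs.v *)
From HB Require Import structures.
From mathcomp Require Import all_boot all_order all_algebra.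
From mathcomp Require Import all_classical all_reals all_analysis.

Set Implicit Arguments.
Unset Strict Implicit.
Unset Printing Implicit Defensive.

Import Order.TTheory GRing.Theory Num.Theory.
Import numFieldNormedType.Exports.

Local Open Scope classical_set_scope.
Local Open Scope ring_scope.

(* A function (0,oo) -> [0,oo) is represented by a total function R -> R whose
   values on (-oo,0] are unconstrained; they are never used below.
   Monotonicity is non-strict. *)
Definition nonneg_nonincreasing (R : realType) (f : R -> R) : Prop :=
  (forall s, 0 < s -> 0 <= f s) /\
  (forall s t, 0 < s -> s <= t -> f t <= f s).

Definition sup_lhs (R : realType) (f : R -> R) : \bar R :=
  ereal_sup [set (t * f t)%:E | t in [set t : R | 0 < t]].

Definition sup_rhs (R : realType) (q : R) (f : R -> R) : \bar R :=
  ereal_sup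
    [set (t%:E *
          ((t^-1)%:E *
           \int[@lebesgue_measure R]_(s in `]t, +oo[) ((f s) `^ q)%:E)
          `^ (q^-1))%E
    | t in [set t : R | (0 < t)%R]].

Definition admissible_constants (R : realType) (q : R) : set R :=
  [set C | 0 < C /\
     forall f : R -> R, nonneg_nonincreasing f ->
       (sup_lhs f <= C%:E * sup_rhs q f)%E].

(* Main.v *)
Require Import Defs.
From HB Require Import structures.
From mathcomp Require Import all_boot all_order all_algebra.
From mathcomp Require Import all_classical all_reals all_analysis.
From mathcomp Require Import measurable_realfun ring.

(** Write [p = 1 / q] and [M = p `^ p * (1 - p) `^ (1 - p)], so that the claimed
    constant is [M^-1].

    The constant works: for [0 < s < t] monotonicity bounds the tail integral
    from below by its part over [`]s, t]], namely
    [\int_s^oo f^q >= (t - s) * f t `^ q].  At [s = (1 - p) * t] the term of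
    the right-hand supremum indexed by [s] is therefore at least [M * (t * f t)]
    (lemma [tail_term_ge]).

    It is minimal: for the indicator function of [`]-oo, 1]] the left-hand
    supremum is at least its value [1] at [t = 1], while the term indexed by
    [t] on the right is [t * (t^-1 * (1 - t)) `^ p] for [t < 1] and [0]
    afterwards.  By the weighted inequality between the arithmetic and
    geometric means this never exceeds [M] (lemma [step_profile_le]), so any
    admissible [C] satisfies [1 <= C * M].  The two halves match because the
    value [s = (1 - p) * t] used in the first one maximizes this profile. *)

Set Implicit Arguments.
Unset Strict Implicit.
Unset Printing Implicit Defensive.

Import Order.TTheory GRing.Theory Num.Theory.
Import numFieldNormedType.Exports.

Local Open Scope classical_set_scope.
Local Open Scope ring_scope.

(** The integral of a nonnegative function is a supremum over the simple
    functions below it, hence monotone even for non-measurable integrands; this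
    spares a proof that monotone functions are measurable. *)
Lemma integral_ge0_homo d (T : measurableType d) (R : realType)
    (mu : {measure set T -> \bar R}) (D : set T) (f g : T -> \bar R) :
  (forall x, D x -> (0 <= f x)%E) -> (forall x, D x -> (f x <= g x)%E) ->
  (\int[mu]_(x in D) f x <= \int[mu]_(x in D) g x)%E.
Proof.
move=> f0 fg; rewrite !(integral_mkcond D).
have fgD x : ((f \_ D) x <= (g \_ D) x)%E.
  by rewrite !patchE; case: ifPn => // /[!inE]; exact: fg.
have f0D x : (0 <= (f \_ D) x)%E by exact: erestrict_ge0.
rewrite !ge0_integralTE//; last by move=> x; exact: le_trans (fgD x).
apply: ereal_sup_le => _ [h hf <-]; exists h => // x.
exact: le_trans (hf x) (fgD x).
Qed.

Lemma integral_indic_tail (R : realType) (a t : R) :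
  (\int[@lebesgue_measure R]_(x in `]t, +oo[) (\1_(`]-oo, a] : set R) x)%:E =
    (Num.max (a - t) 0)%:E)%E.
Proof.
rewrite integral_indic//.
have -> : `]-oo, a] `&` `]t, +oo[ = `]t, a]%classic :> set R.
  apply/seteqP; split=> x /=; rewrite !in_itv/= andbT.
    by case=> -> ->.
  by case/andP.
have := lebesgue_measure_itv `]t, a]; rewrite /= lte_fin.
case: (ltP t a) => ta ->; first by rewrite -EFinB max_l// subr_ge0 ltW.
by rewrite max_r// subr_le0.
Qed.

Section extremal_constant.
Variables (R : realType) (p : R).
Hypotheses (p0 : 0 < p) (p1 : p < 1).

Definition profile_max : R := p `^ p * (1 - p) `^ (1 - p).

Lemma profile_max_gt0 : 0 < profile_max.
Proof. by rewrite mulr_gt0// powR_gt0// subr_gt0. Qed.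

Lemma mul_powR_ratio (s x : R) : 0 < s -> 0 <= x ->
  s * (s^-1 * x) `^ p = s `^ (1 - p) * x `^ p.
Proof.
move=> s0 x0; rewrite powRM ?invr_ge0 ?(ltW s0)// mulrA; congr (_ * _).
rewrite -powR_inv1 ?(ltW s0)// -powRrM mulN1r powRB; last first.
  by rewrite (gt_eqF s0) implybT.
by rewrite powRr1 ?powRN ?ltW.
Qed.

(** Young's inequality applied to [(s / (1 - p)) `^ (1 - p)] and
    [((1 - s) / p) `^ p] bounds their product by [s + (1 - s) = 1]. *)
Lemma step_profile_le (s : R) : 0 < s -> s <= 1 ->
  s * (s^-1 * (1 - s)) `^ p <= profile_max.
Proof.
move=> s0 s1; have p'0 : 0 < 1 - p by rewrite subr_gt0.
have s'0 : 0 <= 1 - s by rewrite subr_ge0.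
rewrite mul_powR_ratio//.
set a := s / (1 - p); set b := (1 - s) / p.
have a0 : 0 <= a by rewrite divr_ge0 ?ltW.
have b0 : 0 <= b by rewrite divr_ge0 ?(ltW p0).
have -> : s = a * (1 - p) by rewrite divfK ?gt_eqF.
have -> : 1 - a * (1 - p) = b * p by rewrite !divfK ?gt_eqF.
rewrite (powRM _ a0 (ltW p'0)) (powRM _ b0 (ltW p0)).
rewrite mulrACA (mulrC ((1 - p) `^ _)).
apply: ler_piMl; first exact: ltW profile_max_gt0.
have := @conjugate_powR _ (a `^ (1 - p)) (b `^ p) (1 - p)^-1 p^-1.
rewrite !powR_ge0 !invr_gt0 p0 p'0 !invrK -!powRrM !divff ?gt_eqF// subrK.
rewrite !powRr1// !divfK ?gt_eqF// => /(_ isT isT isT isT erefl).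
by rewrite [s + _]addrC subrK.
Qed.

(** On [`]s, t]], of length [p * t], the integrand is at least [f t `^ p^-1];
    discarding the rest of the tail loses nothing for a step function ending at
    [t], which is why the optimal constant survives. *)
Lemma tail_term_ge (f : R -> R) (s t : R) :
  nonneg_nonincreasing f -> 0 < t -> s = (1 - p) * t ->
  ((profile_max * (t * f t))%:E <=
     s%:E * ((s^-1)%:E * \int[@lebesgue_measure R]_(x in `]s, +oo[)
       ((f x) `^ (p^-1))%:E) `^ p)%E.
Proof.
move=> [f0 fni] t0 sE; have p'0 : 0 < 1 - p by rewrite subr_gt0.
have s0 : 0 < s by rewrite sE mulr_gt0.
have st : t - s = p * t by rewrite sE; ring.
have ltst : s < t by rewrite -subr_gt0 st mulr_gt0.
have ft0 := f0 _ t0.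
have tail : ((p * t * f t `^ p^-1)%:E <=
    \int[@lebesgue_measure R]_(x in `]s, +oo[) (f x `^ p^-1)%:E)%E.
  rewrite -st.
  have -> : ((t - s) * f t `^ p^-1)%:E =
      (\int[@lebesgue_measure R]_(x in `]s, +oo[)
        ((f t `^ p^-1)%:E * (\1_(`]-oo, t] : set R) x)%:E))%E.
    rewrite ge0_integralZl_EFin ?powR_ge0//.
      by rewrite integral_indic_tail max_l ?subr_ge0 ?(ltW ltst)// -EFinM mulrC.
    by apply/measurable_EFinP; exact: measurable_indic.
  apply: integral_ge0_homo => x.
    by move=> _; rewrite -EFinM lee_fin mulr_ge0 ?powR_ge0.
  rewrite /= in_itv/= andbT => sx; rewrite -EFinM lee_fin indicE mem_setE.
  have x0 := lt_trans s0 sx.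
  rewrite in_itv/=; case: (leP x t) => xt /=; last by rewrite mulr0 powR_ge0.
  by rewrite mulr1 ge0_ler_powR ?invr_ge0 ?(ltW p0)// ?nnegrE ?f0 ?fni.
have -> : profile_max * (t * f t) =
    s * (s^-1 * (p * t * f t `^ p^-1)) `^ p.
  rewrite mul_powR_ratio ?mulr_ge0 ?powR_ge0 ?ltW// /profile_max sE.
  rewrite !powRM ?mulr_ge0 ?powR_ge0 ?(ltW p0) ?(ltW p'0) ?(ltW t0)//.
  rewrite -powRrM mulVf ?gt_eqF// powRr1//.
  (* the powers of [t] coming from [s] and from [t - s] recombine into [t] *)
  have tE : t = t `^ (1 - p) * t `^ p.
    by rewrite -powRD ?subrK ?powRr1 ?(ltW t0)// oner_eq0.
  rewrite {1}tE; ring.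
rewrite EFinM lee_pmul2l ?lte_fin// -poweR_EFin EFinM.
apply: gt0_ler_poweR; first exact: ltW.
- rewrite in_itv/= leey andbT -EFinM lee_fin.
  by rewrite !mulr_ge0 ?invr_ge0 ?powR_ge0 ?ltW.
- rewrite in_itv/= leey andbT mule_ge0 ?lee_fin ?invr_ge0 ?(ltW s0)//.
  by apply: integral_ge0 => x _; rewrite lee_fin powR_ge0.
- by rewrite lee_pmul2l ?lte_fin ?invr_gt0.
Qed.

(** Equality case of [tail_term_ge] at [t = 1], hence the function to test
    candidate constants against. *)
Definition step : R -> R := \1_`]-oo, 1%R].

Lemma step_nonneg_nonincreasing : nonneg_nonincreasing step.
Proof.
split=> [s _|s t _ st]; first by rewrite /step indicE.
rewrite /step !indicE !mem_setE !in_itv/= ler_nat.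
by case: (leP t 1) => // /(le_trans st) ->.
Qed.

Lemma integral_step_powR (r t : R) : 0 < r ->
  (\int[@lebesgue_measure R]_(x in `]t, +oo[) ((step x) `^ r)%:E =
    (Num.max (1 - t) 0)%:E)%E.
Proof.
move=> r0.
under eq_integral => x _.
  have -> : step x `^ r = \1_(`]-oo, 1] : set R) x.
    by rewrite /step indicE; case: (_ \in _); rewrite ?powR1 ?powR0 ?gt_eqF.
  over.
exact: integral_indic_tail.
Qed.

Lemma sup_rhs_step_le : (sup_rhs p^-1 step <= profile_max%:E)%E.
Proof.
apply: ge_ereal_sup => _ [t /= t0 <-].
rewrite integral_step_powR ?invr_gt0// invrK -EFinM lee_fin.
have [t1|t1] := leP t 1.
  by rewrite max_l ?subr_ge0// step_profile_le.
rewrite max_r ?subr_le0 ?(ltW t1)// mulr0 powR0 ?gt_eqF// mulr0.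
exact: ltW profile_max_gt0.
Qed.

Lemma profile_max_inv_admissible : admissible_constants p^-1 profile_max^-1.
Proof.
have M0 := profile_max_gt0; split; first by rewrite invr_gt0.
move=> f fni; apply: ge_ereal_sup => _ [t /= t0 <-].
rewrite -[t * f t](mulKf (lt0r_neq0 M0)) EFinM.
rewrite lee_pmul2l ?lte_fin ?invr_gt0//.
apply: le_trans (tail_term_ge fni t0 erefl) _.
apply: ereal_sup_ubound; exists ((1 - p) * t); last by rewrite invrK.
by rewrite /= mulr_gt0// subr_gt0.
Qed.

Lemma profile_max_inv_le (C : R) :
  admissible_constants p^-1 C -> profile_max^-1 <= C.
Proof.
move=> [C0 /(_ _ step_nonneg_nonincreasing) CP].
have M0 := profile_max_gt0; rewrite -[leLHS]mul1r ler_pdivrMr//.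
rewrite -lee_fin EFinM; apply: (@le_trans _ _ (sup_lhs step)).
  apply: ereal_sup_ubound; exists 1; first exact: ltr01.
  by rewrite mul1r /step indicE mem_setE in_itv/= lexx.
by apply: le_trans CP _; rewrite lee_pmul2l ?lte_fin ?sup_rhs_step_le.
Qed.

End extremal_constant.

Theorem theorem4p4 (R : realType) (q : R) (hq : 1 < q) :
  let Cbar : R := (1 / q) `^ (- (1 / q)) * (1 - 1 / q) `^ (- (1 - 1 / q)) in
  admissible_constants q Cbar /\
  (forall C : R, admissible_constants q C -> Cbar <= C).
Proof.
move=> Cbar; have q0 : 0 < q by exact: lt_trans hq.
have p0 : 0 < q^-1 by rewrite invr_gt0.
have p1 : q^-1 < 1 by rewrite invf_lt1.
have -> : Cbar = (profile_max q^-1)^-1.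
  by rewrite /Cbar /profile_max !div1r !powRN invfM.
rewrite -[q in admissible_constants q]invrK.
split; first exact: profile_max_inv_admissible.
by move=> C; exact: profile_max_inv_le.
Qed.
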